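(* Let $V$ be a real topological vector space with topological dual $V^*$, let $K$ be a non-empty convex set (in some real vector space), let $k^*:K\to\mathbb{R}$ be a convex functional, let $\mathbb{Q}\subset V$ be a non-empty convex subset which is also closed under addition, and let $h:K\to V$ be $\mathbb{Q}$-concave. Assume that there exist a neighborhood $N\subset V$ of $0$ and a map $s:N\to K$ such that $h(s(v))-v\in\mathbb{Q}$ for all $v\in N$ and $k^*\circ s$ is bounded above on $N$. Then $$\max_{v^*\in V^*}\ \inf_{(k,q)\in K\times\mathbb{Q}}\Big[v^*\big(q-h(k)\big)+k^*(k)\Big]=\inf_{k\in h^{-1}(\mathbb{Q})}k^*(k).$$
   Context: For $x,y\in V$ write $x\ge y$ iff $x-y\in\mathbb{Q}$. The map $h$ is $\mathbb{Q}$-concave if $h(tk_1+(1-t)k_0)\ge t\,h(k_1)+(1-t)h(k_0)$ for all $k_0,k_1\in K$ and $t\in[0,1]$. $h^{-1}(\mathbb{Q})=\{k\in K: h(k)\in\mathbb{Q}\}$. Both sides take values in $\mathbb{R}\cup\{-\infty\}$, and ''max'' means that the supremum over $v^*\in V^*$ is attained. A topological vector space is not assumed Hausdorff or locally convex. *)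

(* Defs.v *)
From mathcomp Require Import all_boot all_order all_algebra.
From mathcomp Require Import all_classical all_reals all_analysis.
Set Implicit Arguments.
Unset Strict Implicit.
Unset Printing Implicit Defensive.
Import Order.TTheory GRing.Theory Num.Theory.
Import numFieldNormedType.Exports.
Local Open Scope classical_set_scope.
Local Open Scope ring_scope.

(* [topologicalLmodType R] is an arbitrary topological vector space: neither
   Hausdorff nor locally convex, unlike the library's [tvsType]. *)
Definition dual_space (R : realType) (V : topologicalLmodType R) :
    set {linear V -> R^o} :=
  [set f | continuous (f : V -> R^o)].

Definition closed_under_addition (V : zmodType) (Q : set V) :=
  forall x y, Q x -> Q y -> Q (x + y).

Definition ge_mod (V : zmodType) (Q : set V) (x y : V) : Prop := Q (x - y).

(* A map defined on a set is a total function of which only the values on the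
   set matter, as in the library's [convex_function]. *)
Definition concave_mod (R : realType) (E V : lmodType R) (Q : set V)
    (K : set E) (h : E -> V) :=
  forall k0 k1 (t : R), K k0 -> K k1 -> 0 <= t <= 1 ->
    ge_mod Q (h (t *: k1 + (1 - t) *: k0)) (t *: h k1 + (1 - t) *: h k0).

Definition dual_functional (R : realType) (E V : lmodType R) (K : set E)
    (Q : set V) (kstar : E -> R) (h : E -> V) (f : {linear V -> R^o}) : \bar R :=
  ereal_inf [set (f (kq.2 - h kq.1) + kstar kq.1)%:E | kq in K `*` Q].

Definition dual_value (R : realType) (E : lmodType R)
    (V : topologicalLmodType R) (K : set E) (Q : set V) (kstar : E -> R)
    (h : E -> V) : \bar R :=
  ereal_sup (dual_functional K Q kstar h @` @dual_space R V).

Definition primal_value (R : realType) (E V : lmodType R) (K : set E)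
    (Q : set V) (kstar : E -> R) (h : E -> V) : \bar R :=
  ereal_inf [set (kstar k)%:E | k in K `&` h @^-1` Q].

(* Main.v *)
(* Perturbing the constraint [h k \in Q] to [h k - v \in Q] gives a value
   function [p] on [V], convex because [h] is [Q]-concave and [Q] is convex and
   stable under addition, and bounded above on [N] thanks to [s].  If [p 0] is
   finite, Hahn-Banach applied to the cone generated by the epigraph of
   [p - p 0] yields a linear [f] with [f <= p - p 0]; being bounded above
   on [N], it is continuous, and it is a dual optimum.  If [p 0 = -oo], weak duality makes
   [f = 0] optimal. *)

Require Import Defs.
From HB Require Import structures.
From mathcomp Require Import all_boot all_order all_algebra.
From mathcomp Require Import all_classical all_reals all_analysis.
From mathcomp Require Import ring lra.
Set Implicit Arguments.
Unset Strict Implicit.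
Unset Printing Implicit Defensive.
Import Order.TTheory GRing.Theory Num.Theory.
Import numFieldNormedType.Exports.
Local Open Scope classical_set_scope.
Local Open Scope ring_scope.

(** * Hahn-Banach theorem for cones in [V * R] *)

(** The last condition is what the existence of a linear functional lying below [C] forces. *)
Definition epigraph_cone (R : realType) (V : lmodType R) (C : set (V * R)) :=
  [/\ forall v w a b, C (v, a) -> C (w, b) -> C (v + w, a + b),
      forall c v a, 0 < c -> C (v, a) -> C (c *: v, c * a) &
      forall a, C (0, a) -> 0 <= a].

(** Zorn's lemma: any two points of the union of a chain lie in a common member, so the cone
    conditions pass to the union. *)
Lemma maximal_cone (R : realType) (V : lmodType R) (C : set (V * R)) :
  C !=set0 -> epigraph_cone C ->
  exists D, [/\ C `<=` D, epigraph_cone D &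
    forall B, epigraph_cone B -> D `<=` B -> B `<=` D].
Proof.
move=> C0 coneC.
(* The guard [D !=set0] lets the union of the empty chain satisfy [P]. *)
pose P (D : set (V * R)) := (D !=set0 -> C `<=` D) /\ epigraph_cone D.
have [F FP chainF|D [[CD coneD] maxD]] := @Zorn_bigcup _ P.
  split.
    move=> [x [X FX Xx]] y Cy; exists X => //.
    by apply: (FP X FX).1 => //; exists x.
  have sub2 x y : (\bigcup_(X in F) X) x -> (\bigcup_(X in F) X) y ->
      exists X, [/\ F X, X x & X y].
    move=> [X FX Xx] [Y FY Yy].
    have [XY|YX] := chainF _ _ FX FY.
      by exists Y; split => //; exact: XY.
    by exists X; split => //; exact: YX.
  split.
  - move=> v w a b /sub2/[apply] -[X [FX Xv Xw]]; exists X => //.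
    by have [_ [+ _ _]] := FP _ FX; apply.
  - move=> c v a c0 [X FX Xv]; exists X => //.
    by have [_ [_ + _]] := FP _ FX; apply.
  - by move=> a [X FX X0]; have [_ [_ _]] := FP _ FX; apply.
(* If empty, [D] would be properly contained in the admissible [C]. *)
have D0 : D !=set0.
  apply: contrapT => D0; apply: (maxD C).
    split; first by move=> x Dx; case: D0; exists x.
    by case: C0 => x Cx CD'; apply: D0; exists x; exact: CD'.
  by split=> // _; exact: subset_refl.
exists D; split => //; first exact: CD.
move=> B coneB DB; apply: contrapT => BD; apply: (maxD B); first by split.
by split => // _; apply: subset_trans DB; exact: CD.
Qed.

(** Adjoining the origin preserves the three conditions, so maximality puts it in [D]. *)
Lemma maximal_cone0 (R : realType) (V : lmodType R) (D : set (V * R)) :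
  epigraph_cone D -> (forall B, epigraph_cone B -> D `<=` B -> B `<=` D) ->
  D (0, 0).
Proof.
move=> [Dadd Dscale Dpos] maxD.
apply: (maxD (D `|` [set (0, 0)])); [|by move=> x; left|by right].
split.
- move=> v w a b [Dv [Dw|[-> ->]]|[-> -> [Dw|[-> ->]]]].
  + by left; exact: Dadd.
  + by rewrite !addr0; left.
  + by rewrite !add0r; left.
  + by rewrite !addr0; right.
- move=> c v a c0 [Dv|[-> ->]]; first by left; exact: Dscale.
  by rewrite scaler0 mulr0; right.
- by move=> a [/Dpos//|[->]].
Qed.

(* If neither [(v, r)] nor any [(- v, b)] with [b < - r] were in [D], the cone
   generated by [D] and [(v, r)] would be a larger admissible cone. *)
Lemma maximal_cone_dichotomy (R : realType) (V : lmodType R) (D : set (V * R)) :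
  epigraph_cone D -> (forall B, epigraph_cone B -> D `<=` B -> B `<=` D) ->
  forall v r, D (v, r) \/ exists2 b, b < - r & D (- v, b).
Proof.
move=> coneD maxD v r.
have D00 := maximal_cone0 coneD maxD.
have [Dadd Dscale Dpos] := coneD.
have [?|noopp] := pselect (exists2 b, b < - r & D (- v, b)); [by right|left].
pose B : set (V * R) := [set x | exists t y, [/\ 0 <= t, D y &
  x = (y.1 + t *: v, y.2 + t * r)]].
apply: (maxD B).
- split.
  + move=> _ _ _ _ [t [[y a] [t0 Dy [-> ->]]]] [u [[z b] [u0 Dz [-> ->]]]].
    exists (t + u), (y + z, a + b); split; [exact: addr_ge0|exact: Dadd|].
    by rewrite /= scalerDl mulrDl; congr pair; exact: addrACA.
  + move=> c _ _ c0 [t [[y a] [t0 Dy [-> ->]]]].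
    exists (c * t), (c *: y, c * a); split; [by rewrite mulr_ge0// ltW| |].
      exact: Dscale.
    by rewrite /= scalerDr mulrDr scalerA mulrA.
  + move=> _ [t [[y a] [t0 Dy [y0 ->]]]] /=.
    move: t0; rewrite le_eqVlt => /predU1P[t0|t0].
      by move: y0 Dy; rewrite -t0 scale0r addr0 mul0r addr0 => <- /Dpos.
    (* A negative height would, after division by [t], give a point of [D] over [- v] strictly below
       [- r], which [noopp] excludes. *)
    rewrite leNgt; apply/negP => lt0; apply: noopp; exists (t^-1 * a).
      by rewrite mulrC ltr_pdivrMr// mulNr mulrC -subr_lt0 opprK.
    have -> : - v = t^-1 *: y.
      move/eqP: y0; rewrite eq_sym addr_eq0 => /eqP ->.
      by rewrite scalerN scalerA mulVf ?gt_eqF// scale1r.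
    by apply: Dscale; rewrite // invr_gt0.
- move=> [y a] Dy; exists 0, (y, a).
  by rewrite scale0r mul0r !addr0.
- by exists 1, (0, 0); rewrite /= scale1r mul1r !add0r.
Qed.

(** Take for [f v] the infimum of the heights over [v] in a maximal cone containing [C]: the cone
    conditions make [f] sublinear, and the dichotomy makes it odd, hence linear. *)
Lemma hahn_banach_cone (R : realType) (V : lmodType R) (C : set (V * R)) :
  epigraph_cone C -> (forall v, exists a, C (v, a)) ->
  exists f : {linear V -> R^o}, forall v a, C (v, a) -> f v <= a.
Proof.
move=> coneC totC.
have C0 : C !=set0 by have [a Ca] := totC 0; exists (0, a).
have [D [CD coneD maxD]] := maximal_cone C0 coneC.
have dichD := maximal_cone_dichotomy coneD maxD.
have [Dadd Dscale Dpos] := coneD.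
pose S v := [set a | D (v, a)].
have S0 v : S v !=set0 by have [a /CD Da] := totC v; exists a.
have infS v : has_inf (S v).
  split; first exact: S0.
  (* Adding [(- v, b)] to [(v, a)] gives a point over 0, so [a + b >= 0]. *)
  have [b Db] := S0 (- v); exists (- b) => a Da.
  rewrite -subr_ge0 opprK; apply: Dpos.
  by rewrite -(subrr v); exact: Dadd.
pose f v : R^o := inf (S v).
have fle v a : D (v, a) -> f v <= a.
  by move=> Da; apply: ge_inf => //; exact: (infS v).2.
have fD v w : f (v + w) <= f v + f w.
  rewrite -lerBlDr; apply: lb_le_inf => // a Da.
  rewrite lerBlDr -lerBlDl; apply: lb_le_inf => // b Db.
  by rewrite lerBlDl; apply: fle; exact: Dadd.
have fZ c v : 0 < c -> f (c *: v) <= c * f v.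
  move=> c0; rewrite -ler_pdivrMl//; apply: lb_le_inf => // a Da.
  by rewrite ler_pdivrMl//; apply: fle; exact: Dscale.
have fN v : f (- v) = - f v.
  apply/le_anti/andP; split.
    (* At height [- f (- v)], the second alternative would give a point over [- v] below the infimum
       [f (- v)]. *)
    rewrite lerNr; have [/fle//|[b]] := dichD v (- f (- v)).
    by rewrite opprK => blt /fle; rewrite leNgt blt.
  rewrite -subr_ge0 opprK addrC; apply: le_trans (fD _ _).
  rewrite subrr; apply: lb_le_inf => // a; exact: Dpos.
have linf : linear f.
  have fDE v w : f (v + w) = f v + f w.
    apply/le_anti; rewrite fD/= -lerBrDr -fN.
    by rewrite -[in leLHS](addrK w v) fD.
  have fZE c v : 0 < c -> f (c *: v) = c * f v.
    move=> c0; apply/le_anti; rewrite fZ//= -ler_pdivlMl//.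
    rewrite -[in leLHS](scalerK (lt0r_neq0 c0) v).
    by apply: fZ; rewrite invr_gt0.
  move=> c v w; rewrite fDE; congr +%R.
  have [c0|c0|->] := ltgtP c 0; [|exact: fZE|].
    by rewrite -[c in LHS]opprK scaleNr fN fZE ?oppr_gt0// mulNr opprK.
  by rewrite !scale0r; apply: (addrI (f 0)); rewrite -fDE !addr0.
pose fL : {linear V -> R^o} :=
  HB.pack f (GRing.isLinear.Build R V R^o *:%R f linf).
by exists fL => v a /CD; exact: fle.
Qed.

(** * Continuity from a one-sided bound near 0 *)

(** Scaling [N] turns [f <= M] into [f <= e] near 0; since the bound is one-sided, it is applied to
    both [y - x] and [x - y]. *)
Lemma continuous_linear_bounded_above (R : realType)
    (V : topologicalLmodType R) (f : {linear V -> R^o}) (N : set V) (M : R) :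
  nbhs 0 N -> (forall v, N v -> f v <= M) -> continuous (f : V -> R^o).
Proof.
move=> N0 fM x.
have nbhs_scale c : \forall y \near x, N (c *: (y - x)).
  have cvg0 : (fun y => c *: (y - x)) @ x --> c *: (x - x).
    apply: (@continuous_comp _ _ _ (fun y => (c : R^o, y - x))
      (fun z : R^o * V => z.1 *: z.2)); last exact: scale_continuous.
    apply: (@cvg_pair _ _ _ _ (nbhs (c : R^o))); first exact: cvg_cst.
    apply: (@continuous_comp _ _ _ (fun y => (y, x))
      (fun z : V * V => z.1 - z.2)); last exact: sub_continuous.
    by apply: (@cvg_pair _ _ _ _ (nbhs x)); [exact: cvg_id|exact: cvg_cst].
  by move: cvg0; rewrite subrr scaler0; apply.
apply/cvgrPdist_le => e e0.
have M0 : 0 < `|M| + 1 by rewrite ltr_wpDl.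
pose c := (`|M| + 1) / e.
have c0 : 0 < c by rewrite divr_gt0.
have fle v : N (c *: v) -> f v <= e.
  move=> /fM; rewrite linearZ/= => /le_trans/(_ (ler_norm M)) cfv.
  rewrite -(ler_pM2l c0) {2}/c divfK ?gt_eqF//.
  by apply: (le_trans cfv); rewrite lerDl.
near=> y; rewrite ler_norml; apply/andP; split.
  rewrite lerNl opprB -linearB; apply: fle.
  by near: y; exact: nbhs_scale.
rewrite -linearB; apply: fle; rewrite -opprB scalerN -scaleNr.
by near: y; exact: nbhs_scale.
Unshelve. all: by end_near. Qed.

(** * Convexity with real coefficients, and the perturbation cone *)

Lemma convex_set_comb (R : realType) (E : lmodType R) (A : set E)
    (x y : E) (t : R) :
  convex_set A -> A x -> A y -> 0 <= t <= 1 -> A (t *: x + (1 - t) *: y).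
Proof.
move=> convA Ax Ay /andP[t0 t1].
by have := convA x y (Itv01 t0 t1) (mem_set Ax) (mem_set Ay); rewrite inE.
Qed.

Lemma convex_function_comb (R : realType) (E : lmodType R) (K : set E)
    (g : E -> R) (x y : E) (t : R) :
  convex_function K g -> K x -> K y -> 0 <= t <= 1 ->
  g (t *: x + (1 - t) *: y) <= t * g x + (1 - t) * g y.
Proof.
move=> convg Kx Ky /andP[t0 t1].
exact: (convg (Itv01 t0 t1) x y (mem_set Kx) (mem_set Ky)).
Qed.

(* Up to infima that are not attained, the cone generated by the epigraph of
   [v |-> inf {kstar k - p0 | h k - v \in Q}]; the scaling factor is [1 / l]. *)
Definition perturbation_cone (R : realType) (E V : lmodType R)
    (K : set E) (Q : set V) (kstar : E -> R) (h : E -> V) (p0 : R) :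
    set (V * R) :=
  [set x | exists l k, [/\ 0 < l, K k, Q (h k - l *: x.1) &
                          kstar k - p0 <= l * x.2]].

(** Sums come from convex combinations of the two witnesses; over 0 the witness is feasible, so its
    cost is at least [p0]. *)
Lemma perturbation_cone_epigraph_cone (R : realType) (E V : lmodType R)
    (K : set E) (Q : set V) (kstar : E -> R) (h : E -> V) (p0 : R) :
  convex_set K -> convex_function K kstar ->
  convex_set Q -> closed_under_addition Q -> concave_mod Q K h ->
  (forall k, K k -> Q (h k) -> p0 <= kstar k) ->
  epigraph_cone (perturbation_cone K Q kstar h p0).
Proof.
move=> convK convkstar convQ addQ concaveh p0_le; split.
- move=> v w a b [l [k [/= l0 Kk Qk ka]]] [m [j [/= m0 Kj Qj jb]]].
  have lm0 : 0 < l + m by rewrite addr_gt0.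
  have lm_neq0 := lt0r_neq0 lm0.
  (* This weight solves [t * l = (1 - t) * m], so that one factor serves both points. *)
  pose t := m / (l + m).
  have t01 : 0 <= t <= 1.
    by apply/andP; split; rewrite ?divr_ge0 ?ler_pdivrMr ?mul1r ?lerDr// ltW.
  have [t0 t1] := andP t01.
  have tl : (1 - t) * m = t * l by rewrite /t; field.
  exists (t * l), (t *: k + (1 - t) *: j); split.
  + by rewrite mulr_gt0// divr_gt0.
  + exact: convex_set_comb.
  (* The concavity defect of [h] plus a convex combination of two elements of [Q]. *)
  + have -> : h (t *: k + (1 - t) *: j) - (t * l) *: (v + w) =
        (h (t *: k + (1 - t) *: j) - (t *: h k + (1 - t) *: h j)) +
        (t *: (h k - l *: v) + (1 - t) *: (h j - m *: w)).
      rewrite !scalerBr scalerDr !scalerA tl.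
      by rewrite [X in _ = _ + X]addrACA -opprD addrA subrK.
    by apply: addQ; [exact: concaveh|exact: convex_set_comb].
  + have kj := convex_function_comb convkstar Kk Kj t01.
    have -> : t * l * (a + b) = t * (l * a) + (1 - t) * (m * b).
      by rewrite mulrDr [in RHS]mulrA [X in _ = _ + X]mulrA tl.
    have ta : t * (kstar k - p0) <= t * (l * a) by rewrite ler_wpM2l.
    have tb : (1 - t) * (kstar j - p0) <= (1 - t) * (m * b).
      by rewrite ler_wpM2l// subr_ge0.
    by lra.
- move=> c v a c0 [l [k [/= l0 Kk Qk ka]]]; exists (l / c), k.
  by rewrite /= divr_gt0// scalerA mulrA divfK ?gt_eqF.
- move=> a [l [k [/= l0 Kk]]]; rewrite scaler0 subr0 => Qk ka.
  by rewrite -(pmulr_rge0 _ l0); apply: le_trans ka; rewrite subr_ge0 p0_le.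
Qed.

(** * Weak and strong duality *)

(** Weak duality: for feasible [k], the choice [q = h k] cancels the term in [f]. *)
Lemma dual_functional_le_primal (R : realType) (E V : lmodType R)
    (K : set E) (Q : set V) (kstar : E -> R) (h : E -> V)
    (f : {linear V -> R^o}) :
  (dual_functional K Q kstar h f <= primal_value K Q kstar h)%E.
Proof.
apply: le_ereal_inf_tmp => _ [k [Kk Qk] <-]; apply: ereal_inf_lbound.
by exists (k, h k) => //=; rewrite subrr linear0 add0r.
Qed.

(** Strong duality, with the optimal functional as a witness, which later gives attainment. *)
Lemma primal_le_dual_functional (R : realType) (E : lmodType R)
    (V : topologicalLmodType R)
    (K : set E) (Q : set V) (kstar : E -> R) (h : E -> V)
    (N : set V) (s : V -> E) (M : R) :
  convex_set K -> convex_function K kstar ->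
  convex_set Q -> closed_under_addition Q -> concave_mod Q K h ->
  nbhs (0 : V) N -> (forall v, N v -> K (s v)) ->
  (forall v, N v -> Q (h (s v) - v)) -> (forall v, N v -> kstar (s v) <= M) ->
  exists2 f, dual_space f &
    (primal_value K Q kstar h <= dual_functional K Q kstar h f)%E.
Proof.
move=> convK convkstar convQ addQ concaveh N0 sK sQ sM.
have primal_le k : K k -> Q (h k) ->
    (primal_value K Q kstar h <= (kstar k)%:E)%E.
  by move=> Kk Qk; apply: ereal_inf_lbound; exists k.
have primal_ltoo : (primal_value K Q kstar h < +oo)%E.
  (* The point [s 0] is feasible because 0 lies in [N]. *)
  have Ns0 := nbhs_singleton N0.
  apply: le_lt_trans (ltry (kstar (s 0))); apply: primal_le; first exact: sK.
  by rewrite -[h _]subr0; exact: sQ.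
case: (primal_value K Q kstar h) primal_le primal_ltoo
  => [p0| |] // primal_le _.
  have {}primal_le k : K k -> Q (h k) -> p0 <= kstar k.
    by move=> Kk /(primal_le _ Kk); rewrite lee_fin.
  have coneP := perturbation_cone_epigraph_cone
    convK convkstar convQ addQ concaveh primal_le.
  have [v|f f_le] := hahn_banach_cone coneP.
    (* Neighborhoods of 0 are absorbing, so the cone has a point over every [v]. *)
    have [c c0 Ncv] : exists2 c : R, 0 < c & N (c *: v).
      have cvg0 : (fun c : R^o => c *: v) @ (0 : R^o) --> (0 : R) *: v.
        apply: (@continuous_comp _ _ _ (fun c => (c, v))
          (fun z : R^o * V => z.1 *: z.2)); last exact: scale_continuous.
        by apply: (@cvg_pair _ _ _ _ (nbhs (0 : R^o)));
          [exact: cvg_id|exact: cvg_cst].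
      move: cvg0; rewrite scale0r => /(_ _ N0) /nbhs_ballP[e /= e0 eN].
      exists (e / 2); first by rewrite divr_gt0.
      apply: eN; rewrite /ball/= sub0r normrN gtr0_norm ?divr_gt0//.
      by rewrite ltr_pdivrMr// ltr_pMr// ltr1n.
    exists (c^-1 * (kstar (s (c *: v)) - p0)), c, (s (c *: v)).
    by split; rewrite /= ?mulVKf ?gt_eqF//; [exact: sK|exact: sQ].
  have f_le_w w k : K k -> Q (h k - w) -> f w <= kstar k - p0.
    move=> Kk Qk; apply: f_le; exists 1, k.
    by rewrite /= scale1r mul1r.
  exists f.
    apply: (@continuous_linear_bounded_above _ _ _ N (M - p0) N0) => v Nv.
    apply: le_trans (f_le_w _ _ (sK _ Nv) (sQ _ Nv)) _.
    by rewrite lerD2r sM.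
  apply: le_ereal_inf_tmp => _ [[k q] /= [Kk Qq] <-]; rewrite lee_fin.
  (* Perturbing by [w = h k - q] leaves exactly [q] in the constraint. *)
  have := f_le_w (h k - q) k Kk.
  rewrite subKr => /(_ Qq); rewrite -opprB linearN; lra.
(* The primal value is [-oo] here, so any continuous functional would do. *)
exists (\0 : {linear V -> R^o}); last exact: leNye.
by move=> x; exact: cvg_cst.
Qed.

Theorem theorem2p27 (R : realType) (E : lmodType R)
    (V : topologicalLmodType R)
    (K : set E) (Q : set V) (kstar : E -> R) (h : E -> V)
    (K0 : K !=set0) (convK : convex_set K)
    (convkstar : convex_function K kstar)
    (Q0 : Q !=set0) (convQ : convex_set Q) (addQ : closed_under_addition Q)
    (concaveh : concave_mod Q K h)
    (hyp : exists (N : set V) (s : V -> E),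
      [/\ nbhs (0 : V) N,
          (forall v, N v -> K (s v)),
          (forall v, N v -> Q (h (s v) - v)) &
          has_ubound [set kstar (s v) | v in N]]) :
  (exists2 f, dual_space f & dual_functional K Q kstar h f
                             = dual_value K Q kstar h) /\
  dual_value K Q kstar h = primal_value K Q kstar h.
Proof.
case: hyp => N [s [N0 sK sQ [M ubM]]].
have sM v : N v -> kstar (s v) <= M by move=> Nv; apply: ubM; exists v.
have [f df pf] := primal_le_dual_functional
  convK convkstar convQ addQ concaveh N0 sK sQ sM.
have dual_le : (dual_value K Q kstar h <= primal_value K Q kstar h)%E.
  by apply: ge_ereal_sup => _ [g _ <-]; exact: dual_functional_le_primal.
have f_le : (dual_functional K Q kstar h f <= dual_value K Q kstar h)%E.
  by apply: ereal_sup_ubound; exists f.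
(* The chain closes: primal value <= value at [f] <= dual value <= primal value. *)
split; last by apply/le_anti; rewrite dual_le (le_trans pf).
by exists f => //; apply/le_anti; rewrite f_le (le_trans dual_le).
Qed.
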